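(* Consider the composite SBMD method described in the context with uniform probabilities $p_1=\dots=p_b=1/b$. Suppose $f(y)\ge f(x)+\langle g(x),y-x\rangle+\frac\mu2\|y-x\|^2$ for all $x,y\in X$ with $\mu>0$, and $V_i(z,x)\le\frac Q2\|z-x\|_i^2$ for all $z,x\in X_i$, $i=1,\dots,b$, with $Q>0$. Suppose that for all $k\ge1$, \[ \gamma_k\le\min\left\{\frac1{2\bar L},\frac{bQ}{\mu}\right\},\qquad \theta_{k+1}=\frac{b\gamma_k}{\Gamma_k}-\frac{(b-1)\gamma_{k+1}}{\Gamma_{k+1}}, \] where $\bar L=\max_iL_i$, $\Gamma_1=1$ and $\Gamma_k=\Gamma_{k-1}\left(1-\frac{\gamma_k\mu}{bQ}\right)$ for $k\ge2$. Then for any $N\ge2$, \[ \mathbb{E}[\phi(\bar x_N)-\phi(x^* )]\le\left[\sum_{k=2}^{N+1}\theta_k\right]^{-1}\left[\left(b-\frac{\mu\gamma_1}{Q}\right)\sum_{i=1}^bV_i(x_1^{(i)},x^{*(i)})+(b-1)\gamma_1[\phi(x_1)-\phi(x^* )]+\sum_{k=1}^N\frac{\gamma_k^2}{\Gamma_k}\sigma^2\right], \] where $x^*$ is the optimal solution of $\min_{x\in X}\phi(x)$ and $\sigma=(\sum_{i=1}^b\sigma_i^2)^{1/2}$.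
   Context: Block structure: for $i=1,\dots,b$, $X_i\subseteq\mathbb{R}^{n_i}$ is a nonempty closed convex set, $X=X_1\times\cdots\times X_b\subseteq\mathbb{R}^n$. Each $\mathbb{R}^{n_i}$ carries a norm $\|\cdot\|_i$ with dual $\|\cdot\|_{i,*}$; $U_i\in\mathbb{R}^{n\times n_i}$ satisfy $(U_1,\dots,U_b)=I_n$, $x^{(i)}:=U_i^Tx$, $\|x\|^2:=\sum_i\|x^{(i)}\|_i^2$. Problem: $\phi(x)=f(x)+\chi(x)$ on $X$, where $f(x)=\mathbb{E}[F(x,\xi)]$ is convex and differentiable with gradient $g$, $g_i:=U_i^Tg$, and $\|g_i(x+U_i\rho)-g_i(x)\|_{i,*}\le L_i\|\rho\|_i$ whenever $x,x+U_i\rho\in X$; $\chi(x)=\sum_{i=1}^b\chi_i(x^{(i)})$ with each $\chi_i:\mathbb{R}^{n_i}\to\mathbb{R}$ closed convex. A stochastic oracle returns $G(x,\xi)$ with $\mathbb{E}[G(x,\xi)]=g(x)$ and $\mathbb{E}[\|G_i(x,\xi)-g_i(x)\|_{i,*}^2]\le\sigma_i^2$ for all $x\in X$ ($G_i=U_i^TG$). Prox setup: $\omega_i:X_i\to\mathbb{R}$ continuously differentiable, 1-strongly convex w.r.t. $\|\cdot\|_i$; $V_i(z,x)=\omega_i(x)-\omega_i(z)-\langle\nabla\omega_i(z),x-z\rangle$; $\mathcal P_i(x,y,\gamma)=\arg\min_{z\in X_i}\{\langle y,z-x\rangle+\frac1\gamma V_i(x,z)+\chi_i(z)\}$. Composite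 SBMD method: given $x_1\in X$, weights with $\theta_1=0$; $\xi_1,\xi_2,\dots$ i.i.d. copies of $\xi$, $i_1,i_2,\dots$ i.i.d. with $\mathrm{Prob}(i_k=i)=p_i$, independent of the $\xi_k$. For $k=1,\dots,N$: $x_{k+1}^{(i_k)}=\mathcal P_{i_k}(x_k^{(i_k)},G_{i_k}(x_k,\xi_k),\gamma_k)$, $x_{k+1}^{(i)}=x_k^{(i)}$ for $i\ne i_k$. Output $\bar x_N=\left(\sum_{k=2}^{N+1}\theta_k\right)^{-1}\sum_{k=2}^{N+1}\theta_kx_k$. Expectations w.r.t. $\{i_k\},\{\xi_k\}$.
   Formalization: The weights θ_k are assumed nonnegative with positive sum (otherwise the average may leave X and the bound can fail), and γ_k and Γ_k are assumed positive so that the formulas are defined. *)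

(* Defs.v *)
From HB Require Import structures.
From mathcomp Require Import all_boot all_order all_algebra.
From mathcomp Require Import all_classical all_reals all_analysis.
Set Implicit Arguments. Unset Strict Implicit. Unset Printing Implicit Defensive.
Import Order.TTheory GRing.Theory Num.Theory.
Import numFieldNormedType.Exports.
Local Open Scope classical_set_scope.
Local Open Scope ring_scope.

Definition dotv (R : realType) (m : nat) (y z : 'rV[R]_m) : R :=
  \sum_(j < m) y ord0 j * z ord0 j.

Definition is_norm (R : realType) (m : nat) (N : 'rV[R]_m -> R) : Prop :=
  [/\ forall x, 0 <= N x,
      forall x, N x = 0 -> x = 0,
      forall (a : R) x, N (a *: x) = `|a| * N x
    & forall x y, N (x + y) <= N x + N y].

Definition dual_norm (R : realType) (m : nat) (N : 'rV[R]_m -> R)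
    (y : 'rV[R]_m) : R :=
  sup [set dotv y z | z in [set z | N z <= 1]].

Definition cvx_subset (R : realType) (m : nat) (A : set 'rV[R]_m) : Prop :=
  forall x y (t : R), A x -> A y -> 0 <= t <= 1 -> A (t *: x + (1 - t) *: y).

Definition cvx_function (R : realType) (m : nat) (h : 'rV[R]_m -> R) : Prop :=
  forall x y (t : R), 0 <= t <= 1 ->
    h (t *: x + (1 - t) *: y) <= t * h x + (1 - t) * h y.

Definition one_strongly_convex_on (R : realType) (m : nat) (A : set 'rV[R]_m)
    (N : 'rV[R]_m -> R) (h : 'rV[R]_m -> R) : Prop :=
  forall x y (t : R), A x -> A y -> 0 <= t <= 1 ->
    h (t *: x + (1 - t) *: y)
      <= t * h x + (1 - t) * h y - t * (1 - t) / 2 * N (x - y) ^+ 2.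

(* h is differentiable on the (convex) set A with gradient dh: for all z, x in A
   the (one-sided, feasible-direction) derivative of h at z in direction x - z
   is <dh z, x - z> *)
Definition grad_on (R : realType) (m : nat) (A : set 'rV[R]_m)
    (h : 'rV[R]_m -> R) (dh : 'rV[R]_m -> 'rV[R]_m) : Prop :=
  forall z x, A z -> A x ->
    (fun t : R => (h (z + t *: (x - z)) - h z) / t) @ (0 : R)^'+
      --> dotv (dh z) (x - z).

Definition bregman (R : realType) (m : nat) (w : 'rV[R]_m -> R)
    (dw : 'rV[R]_m -> 'rV[R]_m) (z x : 'rV[R]_m) : R :=
  w x - w z - dotv (dw z) (x - z).

Definition is_prox (R : realType) (m : nat) (A : set 'rV[R]_m)
    (w : 'rV[R]_m -> R) (dw : 'rV[R]_m -> 'rV[R]_m) (chi : 'rV[R]_m -> R)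
    (x y : 'rV[R]_m) (gam : R) (u : 'rV[R]_m) : Prop :=
  let obj := fun z => dotv y (z - x) + gam^-1 * bregman w dw x z + chi z in
  A u /\ forall z, A z -> obj u <= obj z.

(** * Points of R^n = R^{n_1} x ... x R^{n_b}, stored block by block:
      x : forall i : 'I_b, 'rV_(nb i), with x^{(i)} = x i, and
      x + U_i rho = dfwith x i (x i + rho). *)

Definition bpoint (R : realType) (b : nat) (nb : 'I_b -> nat) : Type :=
  forall i : 'I_b, 'rV[R]_(nb i).

Definition padd (R : realType) b (nb : 'I_b -> nat) (x y : bpoint R nb)
  : bpoint R nb := fun i => x i + y i.
Definition pscale (R : realType) b (nb : 'I_b -> nat) (a : R) (x : bpoint R nb)
  : bpoint R nb := fun i => a *: x i.
Definition psub (R : realType) b (nb : 'I_b -> nat) (x y : bpoint R nb)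
  : bpoint R nb := fun i => x i - y i.
Definition pdot (R : realType) b (nb : 'I_b -> nat) (x y : bpoint R nb) : R :=
  \sum_(i < b) dotv (x i) (y i).
Definition pnorm2 (R : realType) b (nb : 'I_b -> nat)
    (N : forall i : 'I_b, 'rV[R]_(nb i) -> R) (x : bpoint R nb) : R :=
  \sum_(i < b) N i (x i) ^+ 2.
Definition in_prod (R : realType) b (nb : 'I_b -> nat)
    (Xs : forall i : 'I_b, set 'rV[R]_(nb i)) (x : bpoint R nb) : Prop :=
  forall i, Xs i (x i).

(** * Random index/sample sequences and expectation.
   A realization of (i_1, i_2, ...) is I : nat -> 'I_b, and of
   (xi_1, xi_2, ...) is Z : nat -> Xi.  The i_k are i.i.d. uniform on 'I_b,
   the xi_k i.i.d. with law P, all independent; the expectation over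
   (i_k, xi_k)_{k0 <= k < k0 + m} of h is the iterated integral below
   (integration w.r.t. the product law). *)

Definition upd (T : Type) (s : nat -> T) (k : nat) (v : T) : nat -> T :=
  fun j => if j == k then v else s j.

Fixpoint Eiter (R : realType) (b : nat) d (Xi : measurableType d)
    (P : probability Xi R) (m k : nat)
    (h : (nat -> 'I_b) -> (nat -> Xi) -> \bar R)
    (I : nat -> 'I_b) (Z : nat -> Xi) : \bar R :=
  match m with
  | 0 => h I Z
  | m'.+1 =>
      ((b%:R)^-1)%:E *
      \sum_(i < b) \int[P]_xi Eiter P m' k.+1 h (upd I k i) (upd Z k xi)
  end%E.

(* Main.v *)
Require Import Defs.
From HB Require Import structures.
From mathcomp Require Import all_boot all_order all_algebra.
From mathcomp Require Import all_classical all_reals all_analysis.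
From mathcomp Require Import measurable_realfun ring lra.
Set Implicit Arguments.
Unset Strict Implicit.
Unset Printing Implicit Defensive.
Import Order.TTheory GRing.Theory Num.Theory.
Import numFieldNormedType.Exports.
Local Open Scope classical_set_scope.
Local Open Scope ring_scope.

(** For a block update x -> x+ with step size gamma, the descent inequality for f
    along block i, the three-point inequality of the prox step and AM-GM bound
    V(x+, x* ) + gamma (phi(x+) - phi(x* )) by the same quantity at x, plus
    gamma times the linearization of phi at x towards x* in block i, plus
    gamma^2 times the squared noise, plus a term linear in the noise.  Averaging
    over i and xi kills the last term, and strong convexity with V <= Q/2 |.|^2
    turns the linearization into a contraction of V by 1 - gamma mu / (b Q).
    Multiplied by b / Gamma_k these inequalities telescope; the weights theta_k
    are what remains in front of phi(x_k) - phi(x* ).  The telescoping is carried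
    out by backward induction on the iterated integral, with a value function of
    the current iterate.  Integrands depending on iterates need not be measurable:
    they are nonnegative, so their integral is a lower integral, which is bounded
    through an integrable affine function of the oracle plus the squared noise. *)

(** * Inner product on row vectors *)

Section dot_product.
Context (R : realType) (m : nat).
Implicit Types x y z : 'rV[R]_m.

Lemma dotvDl x y z : dotv (x + y) z = dotv x z + dotv y z.
Proof.
by rewrite /dotv -big_split; apply: eq_bigr => j _; rewrite mxE mulrDl.
Qed.

Lemma dotvDr x y z : dotv z (x + y) = dotv z x + dotv z y.
Proof.
by rewrite /dotv -big_split; apply: eq_bigr => j _; rewrite mxE mulrDr.
Qed.

Lemma dotvZr (a : R) x z : dotv z (a *: x) = a * dotv z x.
Proof.
by rewrite /dotv mulr_sumr; apply: eq_bigr => j _; rewrite mxE mulrCA.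
Qed.

Lemma dotvNl x z : dotv (- x) z = - dotv x z.
Proof.
by rewrite /dotv -sumrN; apply: eq_bigr => j _; rewrite mxE mulNr.
Qed.

Lemma dotvNr x z : dotv z (- x) = - dotv z x.
Proof. by rewrite -scaleN1r dotvZr mulN1r. Qed.

Lemma dotv0r z : dotv z 0 = 0.
Proof. by rewrite /dotv big1// => j _; rewrite mxE mulr0. Qed.

Definition dotvE := (dotvDl, dotvDr, dotvNl, dotvNr).

Lemma coord_le_norm x j : `|x ord0 j| <= `|x|.
Proof.
rewrite -[leRHS]/(mx_norm x) mx_normrE.
by apply/bigmax_geP; right; exists (ord0, j).
Qed.

End dot_product.

(** * Equivalence of norms and the duality pairing *)

Section norm_equivalence.
Context (R : realType) (m : nat) (N : 'rV[R]_m -> R).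
Hypothesis normN : is_norm N.
Implicit Types x y z : 'rV[R]_m.

Lemma is_norm_ge0 x : 0 <= N x. Proof. by case: normN. Qed.

Lemma is_normZ (a : R) x : N (a *: x) = `|a| * N x. Proof. by case: normN. Qed.

Lemma is_norm0 : N 0 = 0.
Proof. by rewrite -(scale0r 0) is_normZ normr0 mul0r. Qed.

Lemma is_normN x : N (- x) = N x.
Proof. by rewrite -scaleN1r is_normZ normrN1 mul1r. Qed.

Lemma is_normBC x y : N (x - y) = N (y - x).
Proof. by rewrite -is_normN opprB. Qed.

Lemma is_norm_eq0 x : N x = 0 -> x = 0.
Proof. by case: normN => _ + _ _; exact. Qed.


Lemma ler_is_normD x y : N (x + y) <= N x + N y. Proof. by case: normN. Qed.

Lemma is_norm_le_mx_norm : exists2 K, 0 < K & forall x, N x <= K * `|x|.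
Proof.
exists (1 + \sum_(j < m) N 'e_j).
  by rewrite ltr_wpDr// sumr_ge0// => j _; exact: is_norm_ge0.
move=> x; rewrite {1}(row_sum_delta x) mulrDl mul1r.
apply: (@le_trans _ _ (\sum_(j < m) N 'e_j * `|x|)); last first.
  by rewrite -mulr_suml lerDr.
have: forall v : 'I_m -> 'rV[R]_m, N (\sum_j v j) <= \sum_j N (v j).
  move=> v; elim/big_ind2 : _ => [|a b c e ab ce|//]; first by rewrite is_norm0.
  exact: le_trans (ler_is_normD _ _) (lerD ab ce).
move=> /(_ (fun j => x 0 j *: 'e_j)) /le_trans; apply; apply: ler_sum => j _.
by rewrite is_normZ mulrC ler_wpM2l ?is_norm_ge0// coord_le_norm.
Qed.

Lemma is_norm_continuous : continuous N.
Proof.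
have [K K0 NK] := is_norm_le_mx_norm; move=> x.
apply/(@cvgrPdist_lt _ _ _ (nbhs x) (nbhs_filter x)) => e e0.
have /cvgrPdist_lt/(_ _ (divr_gt0 e0 K0)) : y @[y --> x] --> x by exact: cvg_id.
apply: filterS => y xyK.
have xy : N (x - y) < e.
  by rewrite (le_lt_trans (NK _))// mulrC -ltr_pdivlMr.
rewrite (le_lt_trans _ xy)// ler_norml; apply/andP; split.
  have := ler_is_normD x (y - x); rewrite addrC subrK (is_normBC y).
  lra.
have := ler_is_normD y (x - y); rewrite addrC subrK.
lra.
Qed.

(** [N] is continuous, so it attains a minimum on the compact unit sphere of the max norm. The
    minimum is positive, and homogeneity extends the bound to all vectors. *)
Lemma mx_norm_le_is_norm : exists2 C, 0 < C & forall x, `|x| <= C * N x.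
Proof.
pose S := [set x : 'rV[R]_m | `|x| = 1].
have onto_S x : x != 0 -> S (`|x|^-1 *: x).
  move=> x0; rewrite /S /= normrZ ger0_norm ?invr_ge0//.
  by rewrite mulVf// normr_eq0.
(* The sphere is empty when [m = 0]; the only vector is then 0. *)
have [[x Sx]|S0] := pselect (S !=set0); last first.
  exists 1 => // x; rewrite mul1r.
  have [->|/onto_S Sx] := eqVneq x 0; first by rewrite normr0 is_norm_ge0.
  by exfalso; apply: S0; exists (`|x|^-1 *: x).
have cS : compact S.
  apply: bounded_closed_compact.
    exists 1; split; first exact: real1.
    by move=> M M1 y; rewrite /S /= => ->; exact: ltW.
  have -> : S = Num.norm @^-1` [set 1] by [].
  apply: closed_comp; last exact: closed_eq.
  by move=> y _; exact: norm_continuous.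
have [|c] := @compact_EVT_min _ _ N S (ex_intro _ x Sx) cS.
  exact/continuous_subspaceT/is_norm_continuous.
rewrite inE => Sc cmin.
have Nc : 0 < N c.
  rewrite lt_neqAle is_norm_ge0 andbT eq_sym; apply/eqP => /is_norm_eq0 c0.
  by move: Sc; rewrite /S c0 /= normr0 => /eqP; rewrite eq_sym oner_eq0.
exists (N c)^-1; first by rewrite invr_gt0.
move=> y; have [->|y0] := eqVneq y 0.
  by rewrite normr0 mulr_ge0 ?is_norm_ge0// invr_ge0 ltW.
rewrite mulrC ler_pdivlMr//.
have := cmin _ (mem_set (onto_S _ y0)).
rewrite is_normZ ger0_norm ?invr_ge0// mulrC ler_pdivlMr ?normr_gt0//.
by rewrite mulrC.
Qed.

(** By norm equivalence the unit ball of [N] is bounded, so the [sup] in [dual_norm] is a genuine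
    supremum rather than a default value. *)
Lemma has_sup_dual_norm y : has_sup [set dotv y z | z in [set z | N z <= 1]].
Proof.
split; first by exists (dotv y 0), 0 => //=; rewrite is_norm0.
have [C C0 NC] := mx_norm_le_is_norm.
exists (\sum_(j < m) `|y ord0 j| * C) => _ [z /= Nz <-].
apply: ler_sum => j _.
apply: le_trans (ler_norm _) _; rewrite normrM ler_wpM2l//.
apply: le_trans (coord_le_norm _ _) _; apply: le_trans (NC _) _.
by rewrite ger_pMr.
Qed.

Lemma dotv_le_dual_norm y z : dotv y z <= dual_norm N y * N z.
Proof.
have [->|z0] := eqVneq z 0; first by rewrite dotv0r is_norm0 mulr0.
have Nz : 0 < N z.
  rewrite lt_neqAle is_norm_ge0 andbT eq_sym.
  by apply/eqP => /is_norm_eq0; exact/eqP.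
rewrite -ler_pdivrMr// mulrC -dotvZr.
apply: (sup_upper_bound (has_sup_dual_norm y)).
exists ((N z)^-1 *: z) => //=.
by rewrite is_normZ ger0_norm ?invr_ge0 ?is_norm_ge0// mulVf// gt_eqF.
Qed.

End norm_equivalence.

(** * Bregman distances and the prox step *)

Section prox.
Context (R : realType) (m : nat) (A : set 'rV[R]_m) (N : 'rV[R]_m -> R).
Context (w chi : 'rV[R]_m -> R) (dw : 'rV[R]_m -> 'rV[R]_m).
Hypotheses (normN : is_norm N) (cvxA : cvx_subset A) (gradw : grad_on A w dw).
Hypotheses (scw : one_strongly_convex_on A N w) (cvxchi : cvx_function chi).
Implicit Types x y z u : 'rV[R]_m.

Let segE (t : R) x z : z + t *: (x - z) = t *: x + (1 - t) *: z.
Proof. by rewrite scalerBl scale1r scalerBr addrCA addrA. Qed.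

Lemma grad_le z x c e : A z -> A x ->
  (forall t, 0 < t <= 1 -> w (z + t *: (x - z)) - w z <= t * (c + t * e)) ->
  dotv (dw z) (x - z) <= c.
Proof.
move=> Az Ax h.
have q := gradw Az Ax.
have te : (t * e) @[t --> (0:R)^'+] --> (0 : R).
  rewrite -[X in _ --> X](mul0r e); apply: cvgMl.
  exact: cvg_at_right_filter cvg_id.
rewrite -[leLHS]subr0; apply: (cvgr_to_le (cvgB q te)).
near=> t.
have t0 : 0 < t by [].
have t1 : t <= 1 by near: t; apply: nbhs_right_le; exact: ltr01.
rewrite lerBlDr ler_pdivrMr// [_ * t]mulrC.
by apply: h; rewrite t0.
Unshelve. all: by end_near. Qed.

Lemma grad_ge z x c : A z -> A x ->
  (forall t, 0 < t <= 1 -> t * c <= w (z + t *: (x - z)) - w z) ->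
  c <= dotv (dw z) (x - z).
Proof.
move=> Az Ax h; apply: (cvgr_to_ge (gradw Az Ax)).
near=> t.
have t0 : 0 < t by [].
have t1 : t <= 1 by near: t; apply: nbhs_right_le; exact: ltr01.
rewrite ler_pdivlMr// mulrC.
by apply: h; rewrite t0.
Unshelve. all: by end_near. Qed.

(** Strong convexity on the segment from [z] to [x] bounds the increment of [w] by
    [t * (c + t * e)], with [e] half the squared norm; dividing by [t] and letting it tend to 0
    leaves [c]. *)
Lemma half_sqr_norm_le_bregman z x : A z -> A x ->
  N (x - z) ^+ 2 / 2 <= bregman w dw z x.
Proof.
move=> Az Ax; rewrite /bregman lerBrDr addrC -lerBrDr.
apply: (@grad_le _ _ _ (N (x - z) ^+ 2 / 2)) => // t /andP[t0 t1].
rewrite segE.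
have t01 : 0 <= t <= 1 by rewrite ltW.
have := scw Ax Az t01; nra.
Qed.

Lemma bregman_three_point x u z :
  bregman w dw x z - bregman w dw u z - bregman w dw x u =
  dotv (dw u - dw x) (z - u).
Proof. by rewrite /bregman !dotvE; ring. Qed.

Lemma prox_opt x y (gam : R) u z : 0 < gam -> A z -> is_prox A w dw chi x y gam u ->
  gam * (dotv y (u - z) + chi u - chi z) <=
  bregman w dw x z - bregman w dw x u.
Proof.
move=> gam0 Az [_ /(_ z Az)] /(ler_wpM2l (ltW gam0)).
rewrite /= !mulrDr !(mulrA gam gam^-1) mulfV ?gt_eqF// !mul1r /bregman !dotvE.
lra.
Qed.

(** Optimality of [u] is tested at [u + t *: (z - u)]. Convexity bounds the increment of [chi]
    linearly in [t], so the limit gives the first-order condition on [dw u] without differentiating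
    [chi]. *)
Lemma prox_three_point x y (gam : R) u z : 0 < gam -> A x -> A z ->
  is_prox A w dw chi x y gam u ->
  gam * (dotv y (u - z) + chi u - chi z) <=
  bregman w dw x z - bregman w dw u z - bregman w dw x u.
Proof.
move=> gam0 Ax Az pu; have [Au _] := pu.
rewrite bregman_three_point dotvDl dotvNl.
suff : dotv (dw x) (z - u) - gam * (dotv y (z - u) + chi z - chi u) <=
    dotv (dw u) (z - u) by rewrite !dotvE; lra.
apply: grad_ge => // t /andP[t0 t1].
have t01 : 0 <= t <= 1 by rewrite ltW.
have Azt : A (u + t *: (z - u)) by rewrite segE; exact: cvxA.
have := prox_opt gam0 Azt pu.
have := ler_wpM2l (ltW gam0) (cvxchi z u t01).
rewrite -segE /bregman !dotvE !dotvZr !dotvE; lra.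
Qed.

(** Adding the three-point inequality of [u] tested at [v] to the optimality of [v] tested at [u]
    makes the Bregman distance from [u] to [v] nonpositive. *)
Lemma prox_unique x y (gam : R) u v : 0 < gam -> A x ->
  is_prox A w dw chi x y gam u -> is_prox A w dw chi x y gam v -> u = v.
Proof.
move=> gam0 Ax pu pv.
have [Au _] := pu; have [Av _] := pv.
have h1 := prox_three_point gam0 Ax Av pu.
have h2 := prox_opt gam0 Au pv.
have V0 := half_sqr_norm_le_bregman Au Av.
have /eqP : N (v - u) ^+ 2 = 0.
  apply/eqP; rewrite eq_le sqr_ge0 andbT.
  by move: h1 h2; rewrite !dotvE; lra.
by rewrite expf_eq0 /= => /eqP/(is_norm_eq0 normN)/eqP; rewrite subr_eq0 => /eqP.
Qed.

End prox.

(** * Descent inequality along one block *)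

Section block_step.
Context (R : realType) (b : nat) (nb : 'I_b -> nat).
Context (Xs : forall i : 'I_b, set 'rV[R]_(nb i)).
Arguments Xs : clear implicits.
Context (f : bpoint R nb -> R) (g : bpoint R nb -> bpoint R nb).
Hypothesis cvxXs : forall i, cvx_subset (Xs i).
Hypothesis derf : forall y v : bpoint R nb,
  is_derive (0 : R) 1 (fun t : R => f (padd y (pscale t v))) (pdot (g y) v).
Implicit Types y z v : bpoint R nb.

Lemma is_derive_line y v (t : R) :
  is_derive t 1 (fun s : R => f (padd y (pscale s v)))
    (pdot (g (padd y (pscale t v))) v).
Proof.
pose h s := f (padd (padd y (pscale t v)) (pscale s v)).
have -> : (fun s : R => f (padd y (pscale s v))) = h \o (fun s => s - t).
  apply/funext => s; rewrite /h /=; congr f; apply/functional_extensionality_dep.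
  by move=> i; rewrite /padd /pscale scalerBl -addrA subrKC.
have dh : is_derive (t - t) (1 : R) h (pdot (g (padd y (pscale t v))) v).
  by rewrite subrr; exact: derf.
have ds : is_derive t (1 : R) (fun s : R => s - t) 1.
  by rewrite -[X in is_derive _ _ _ X]subr0; exact: is_deriveB.
by have := @is_derive1_comp R h (fun s => s - t) t _ _ dh ds; rewrite mulr1.
Qed.

Lemma dfwith_line y i rho (t : R) :
  padd y (pscale t (dfwith (fun=> 0) i rho)) = dfwith y i (y i + t *: rho).
Proof.
apply/functional_extensionality_dep => j; rewrite /padd /pscale.
by have [<-|ij] := eqVneq i j; rewrite ?dfwithin// !dfwithout// scaler0 addr0.
Qed.

Lemma pdot_dfwith y i rho : pdot y (dfwith (fun=> 0) i rho) = dotv (y i) rho.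
Proof.
rewrite /pdot (bigD1 i)//= dfwithin big1 ?addr0// => j ij.
by rewrite dfwithout ?dotv0r// eq_sym.
Qed.

Lemma in_prod_dfwith y i r : in_prod Xs y -> Xs i r -> in_prod Xs (dfwith y i r).
Proof.
move=> Xy Xr j; have [<-|ij] := eqVneq i j; first by rewrite dfwithin.
by rewrite dfwithout.
Qed.

Context (i : 'I_b) (N : 'rV[R]_(nb i) -> R) (L : R).
Hypothesis normN : is_norm N.
Hypothesis lipg : forall y (rho : 'rV[R]_(nb i)),
  in_prod Xs y -> in_prod Xs (dfwith y i (y i + rho)) ->
  dual_norm N (g (dfwith y i (y i + rho)) i - g y i) <= L * N rho.

(** The mean value theorem is applied to [k], which is [f] on the segment minus its linear and
    quadratic models. The Lipschitz bound on the block gradient makes its derivative nonpositive. *)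
Lemma block_descent y r : in_prod Xs y -> Xs i r ->
  f (dfwith y i r) <= f y + dotv (g y i) (r - y i) + L / 2 * N (r - y i) ^+ 2.
Proof.
move=> Xy Xr; set rho := r - y i; set D := dotv (g y i) rho.
pose v : bpoint R nb := dfwith (fun=> 0) i rho.
pose h (t : R) : R := f (padd y (pscale t v)).
pose c := L * N rho ^+ 2.
pose k : R -> R := h - D \*: id - (c / 2) \*: (id ^+ 2).
pose dk (t : R) := pdot (g (padd y (pscale t v))) v - D - c * t.
have dk_k (t : R) : is_derive t 1 k (dk t).
  have dh : is_derive t 1 h _ := is_derive_line y v t.
  apply: is_derive_eq.
  by rewrite /dk /GRing.scale /= mulr1 expr1; field.
have dk_le0 t : 0 < t < 1 -> dk t <= 0.
  move=> /andP[t0 t1]; rewrite /dk dfwith_line pdot_dfwith subr_le0 lerBlDr.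
  (* The Lipschitz bound holds only inside the feasible set; convexity keeps the intermediate points
     there. *)
  have Xt : in_prod Xs (dfwith y i (y i + t *: rho)).
    apply: in_prod_dfwith => //.
    rewrite /rho scalerBr addrCA -[X in X - _]scale1r -scalerBl.
    by apply: cvxXs => //; rewrite !ltW.
  rewrite -lerBlDr -dotvNl -dotvDl.
  rewrite (le_trans (dotv_le_dual_norm normN _ _))//.
  rewrite (le_trans (ler_wpM2r (is_norm_ge0 normN _) (lipg Xy Xt)))//.
  by rewrite is_normZ// gtr0_norm// /c expr2 !mulrA -[L * t * _]mulrA
    [t * _]mulrC !mulrA [_ * t * _]mulrAC.
have ck : {within `[0, 1], continuous k}.
  by apply: derivable_within_continuous => t _; case: (dk_k t).
have [t + kE] := MVT ltr01 (fun t _ => dk_k t) ck.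
rewrite in_itv/= => /dk_le0 dkt; move: kE; rewrite subr0 mulr1.
have h1 : h 1 = f (dfwith y i r).
  by rewrite /h dfwith_line scale1r addrC subrK.
have h0 : h 0 = f y.
  rewrite /h; congr f; apply/functional_extensionality_dep => j.
  by rewrite /padd /pscale scale0r addr0.
have -> : k 1 - k 0 = h 1 - D - c / 2 - h 0.
  by rewrite /k !fctE /= /GRing.scale /=; field.
rewrite h1 h0 /c => kE; move: dkt; rewrite -kE; lra.
Qed.

End block_step.

(** * Integrals of nonnegative, possibly nonmeasurable functions *)

Section lower_integral.
Context d (T : measurableType d) (R : realType) (P : {measure set T -> \bar R}).

Import HBNNSimple.

(* The integral of a nonnegative function is a supremum over the simple functions
   below it, so no measurability is needed. *)
Lemma ge0_le_lower_integral (F1 F2 : T -> \bar R) :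
  (forall x, 0 <= F1 x)%E -> (forall x, F1 x <= F2 x)%E ->
  (\int[P]_x F1 x <= \int[P]_x F2 x)%E.
Proof.
move=> F10 F12; have F20 x : (0 <= F2 x)%E by exact: le_trans (F12 x).
rewrite !ge0_integralTE//; apply: le_ereal_sup => _ [s /= sF1 <-].
by exists s => //= x; exact: le_trans (sF1 x) (F12 x).
Qed.

(** A simple [s] below [F] satisfies [s <= a + p], with [p] the positive part of [s - a]. This [p]
    is a measurable function below [c * D], and stands in for it. *)
Lemma lower_integral_le_affine (F : T -> \bar R) (a D : T -> R) (c A M : R) :
  0 < c -> (forall x, 0 <= F x)%E -> (forall x, F x <= (a x + c * D x)%:E)%E ->
  P.-integrable setT (EFin \o a) -> (\int[P]_x (a x)%:E = A%:E)%E ->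
  (\int[P]_x (D x)%:E <= M%:E)%E ->
  (forall x, 0 <= D x) ->
  (\int[P]_x F x <= (A + c * M)%:E)%E.
Proof.
move=> c0 F0 FaD inta intA intD D0.
rewrite ge0_integralTE//; apply: ge_ereal_sup => _ [s /= sF <-].
have sa x : s x <= a x + c * D x by rewrite -lee_fin; exact: le_trans (sF x) _.
have s0 x : 0 <= s x by exact: fun_ge0.
have ma : measurable_fun setT a.
  by apply/measurable_EFinP; exact: measurable_int inta.
have ms : measurable_fun setT s by exact: measurable_funP.
pose p x := Num.max (s x - a x) 0.
have p0 x : 0 <= p x by rewrite le_max lexx orbT.
have mp : measurable_fun setT p.
  by apply: measurable_funrpos; exact: measurable_funB.
have intp : (\int[P]_x (p x)%:E <= (c * M)%:E)%E.
  (* The constant is moved onto [p], where linearity is available by measurability; [D] enters only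
     through monotonicity. *)
  have h : (\int[P]_x (c^-1 * p x)%:E <= M%:E)%E.
    apply: le_trans intD; apply: ge0_le_lower_integral => x; rewrite lee_fin.
      by rewrite mulr_ge0// invr_ge0 ltW.
    by rewrite mulrC ler_pdivrMr// mulrC ge_max lerBlDl sa mulr_ge0// ltW.
  have -> : (\int[P]_x (p x)%:E = c%:E * \int[P]_x (c^-1 * p x)%:E)%E.
    rewrite -ge0_integralZl//.
    - by apply: eq_integral => x _; rewrite -EFinM mulrA mulfV ?gt_eqF// mul1r.
    - by apply/measurable_EFinP; exact: measurable_funM.
    - by move=> x _; rewrite lee_fin mulr_ge0// invr_ge0 ltW.
    - by rewrite lee_fin ltW.
  by rewrite EFinM lee_wpmul2l// lee_fin ltW.
have inp : P.-integrable setT (EFin \o p).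
  apply/integrableP; split; first exact/measurable_EFinP.
  under eq_integral do rewrite /= ger0_norm//.
  exact: le_lt_trans intp (ltry _).
have sap x : s x <= a x + p x by rewrite -lerBlDl le_max lexx.
have inap := integrableD measurableT inta inp.
have ins : P.-integrable setT (EFin \o s).
  apply: le_integrable inap => //; first exact/measurable_EFinP.
  move=> x _; rewrite /= lee_fin ger0_norm// (le_trans (sap x))//.
  exact: ler_norm.
have -> : (sintegral P s = \int[P]_x (s x)%:E)%E.
  by rewrite integral_nnsfun// patch_setT.
apply: (@le_trans _ _ (\int[P]_x ((a x)%:E + (p x)%:E)))%E.
  by apply: le_integral => // x _; rewrite -EFinD lee_fin.
by rewrite integralD// EFinD intA leeD2l.
Qed.

End lower_integral.

(** * Jensen's inequality for weighted averages of points *)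

Section jensen.
Context (R : realType) (b : nat) (nb : 'I_b -> nat).
Implicit Types y z : bpoint R nb.
Context (X : bpoint R nb -> Prop) (F : bpoint R nb -> R).
Hypothesis cvxX : forall y z (t : R), X y -> X z -> 0 <= t <= 1 ->
  X (padd (pscale t y) (pscale (1 - t) z)).
Hypothesis cvxF : forall y z (t : R), X y -> X z -> 0 <= t <= 1 ->
  F (padd (pscale t y) (pscale (1 - t) z)) <= t * F y + (1 - t) * F z.

(** Membership of the average is proved together with the inequality, because [F] is convex only on
    [X] and the induction applies convexity to the tail average. *)
Lemma jensen_bpoint (I : eqType) (s : seq I) (w : I -> R) (p : I -> bpoint R nb)
    (W := \sum_(k <- s) w k)
    (avg := (fun i => W^-1 *: \sum_(k <- s) w k *: p k i) : bpoint R nb) :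
  {in s, forall k, 0 <= w k} -> {in s, forall k, X (p k)} -> 0 < W ->
  X avg /\ W * F avg <= \sum_(k <- s) w k * F (p k).
Proof.
rewrite {}/avg {}/W; elim: s => [|k s IH] w0 Xp; first by rewrite big_nil ltxx.
have sks j : j \in s -> j \in k :: s by rewrite in_cons orbC => ->.
have {}IH := IH (fun j js => w0 j (sks j js)) (fun j js => Xp j (sks j js)).
have wk0 : 0 <= w k by apply: w0; exact: mem_head.
have Xk : X (p k) by apply: Xp; exact: mem_head.
have ws0 : 0 <= \sum_(j <- s) w j.
  by rewrite big_seq sumr_ge0// => j js; exact/w0/sks.
rewrite !big_cons; set W := \sum_(j <- s) w j => Wpos.
(* If the tail has total weight 0, its average is not a convex combination; all its weights vanish
   and only the head remains. *)
have [W0|Wn0] := eqVneq W 0.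
  have wj0 j : j \in s -> w j = 0.
    move=> js; move: W0; rewrite /W big_seq => /eqP.
    rewrite psumr_eq0 => [/allP/(_ j js)|i si]; last first.
      exact/w0/sks.
    by rewrite js => /eqP.
  rewrite W0 addr0 in Wpos *.
  have -> : (fun i => (w k)^-1 *: \sum_(j <- k :: s) w j *: p j i) = p k.
    apply/functional_extensionality_dep => i.
    rewrite big_cons big_seq big1 => [|j js]; last by rewrite wj0// scale0r.
    by rewrite addr0 scalerA mulVf ?scale1r// gt_eqF.
  split=> //; rewrite big_seq big1 ?addr0// => j js.
  by rewrite wj0// mul0r.
have W0 : 0 < W by rewrite lt_neqAle eq_sym Wn0.
have [Xavg Favg] := IH W0.
pose t := w k / (w k + W).
have t01 : 0 <= t <= 1.
  by rewrite divr_ge0 ?(ltW Wpos)//= ler_pdivrMr// mul1r lerDl.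
have tE : 1 - t = W / (w k + W) by rewrite /t; field; rewrite gt_eqF.
have -> : (fun i => (w k + W)^-1 *: \sum_(j <- k :: s) w j *: p j i) =
    padd (pscale t (p k))
      (pscale (1 - t) (fun i => W^-1 *: \sum_(j <- s) w j *: p j i)).
  apply/functional_extensionality_dep => i; rewrite /padd /pscale tE big_cons.
  rewrite scalerDr !scalerA; congr (_ *: _ + _ *: _); first exact: mulrC.
  by rewrite mulrAC mulfV ?mul1r.
split; first exact: cvxX.
apply: le_trans (lerD (lexx (w k * F (p k))) Favg).
have := cvxF Xk Xavg t01; rewrite tE -(ler_pM2l Wpos) => /le_trans; apply.
rewrite -/W; move: (F (fun i => _)) => Fs.
by rewrite le_eqVlt; apply/orP; left; apply/eqP; rewrite /t; field; rewrite gt_eqF.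
Qed.

End jensen.

(** * One step of the method, in expectation *)

Section stochastic_block_mirror_descent.
Context (R : realType) (b : nat) (nb : 'I_b -> nat).
Context (Xs : forall i : 'I_b, set 'rV[R]_(nb i)).
Context (Nm : forall i : 'I_b, 'rV[R]_(nb i) -> R).
Context (f : bpoint R nb -> R) (g : bpoint R nb -> bpoint R nb).
Context (chi : forall i : 'I_b, 'rV[R]_(nb i) -> R) (L : 'I_b -> R).
Context d (Xi : measurableType d) (P : probability Xi R).
Context (G : bpoint R nb -> Xi -> bpoint R nb) (sigma : 'I_b -> R).
Context (om : forall i : 'I_b, 'rV[R]_(nb i) -> R).
Context (dom : forall i : 'I_b, 'rV[R]_(nb i) -> 'rV[R]_(nb i)).
Context (mu Q : R).
Arguments Xs : clear implicits.
Arguments Nm : clear implicits.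
Arguments chi : clear implicits.
Arguments om : clear implicits.
Arguments dom : clear implicits.
Implicit Types y z : bpoint R nb.
Hypothesis b0 : (0 < b)%N.
Hypothesis cvxXs : forall i, cvx_subset (Xs i).
Hypothesis normNm : forall i, is_norm (Nm i).
Hypothesis derf : forall y v : bpoint R nb,
  is_derive (0 : R) 1 (fun t : R => f (padd y (pscale t v))) (pdot (g y) v).
Hypothesis lipg : forall y (i : 'I_b) (rho : 'rV[R]_(nb i)),
  in_prod Xs y -> in_prod Xs (dfwith y i (y i + rho)) ->
  dual_norm (Nm i) (g (dfwith y i (y i + rho)) i - g y i) <= L i * Nm i rho.
Hypothesis cvxchi : forall i, cvx_function (chi i).
Hypothesis G_mean : forall y (i : 'I_b) (j : 'I_(nb i)), in_prod Xs y ->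
  P.-integrable setT (fun xi => (G y xi i ord0 j)%:E) /\
  (\int[P]_xi (G y xi i ord0 j)%:E = (g y i ord0 j)%:E)%E.
Hypothesis G_var : forall y (i : 'I_b), in_prod Xs y ->
  (\int[P]_xi ((dual_norm (Nm i) (G y xi i - g y i)) ^+ 2)%:E
     <= (sigma i ^+ 2)%:E)%E.
Hypothesis grad_om : forall i, grad_on (Xs i) (om i) (dom i).
Hypothesis sc_om : forall i, one_strongly_convex_on (Xs i) (Nm i) (om i).
Hypothesis mu0 : 0 < mu.
Hypothesis sc_f : forall y z, in_prod Xs y -> in_prod Xs z ->
  f z >= f y + pdot (g y) (psub z y) + mu / 2 * pnorm2 Nm (psub z y).
Hypothesis Q0 : 0 < Q.
Hypothesis bregman_quad : forall i (z y : 'rV[R]_(nb i)), Xs i z -> Xs i y ->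
  bregman (om i) (dom i) z y <= Q / 2 * Nm i (z - y) ^+ 2.

Let phi y := f y + \sum_(i < b) chi i (y i).
Let V y z := \sum_(i < b) bregman (om i) (dom i) (y i) (z i).
Let potential (gam : R) z y := V y z + gam * (phi y - phi z).
Let slope y z (i : 'I_b) :=
  dotv (g y i) (z i - y i) + chi i (z i) - chi i (y i).

(** The prox step yields a spare [n ^+ 2 / 2], where [n] is the step length. The descent inequality
    uses half of it, since [2 * L i * gam <= 1], and AM-GM on the noise uses the other half. *)
Lemma bregman_block_step y z i Gi (gam : R) u :
  in_prod Xs y -> in_prod Xs z -> 0 < gam -> 2 * L i * gam <= 1 ->
  is_prox (Xs i) (om i) (dom i) (chi i) (y i) Gi gam u ->
  bregman (om i) (dom i) u (z i) + gam * (f (dfwith y i u) + chi i u) <=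
  bregman (om i) (dom i) (y i) (z i) + gam * (f y + chi i (y i))
    + gam * slope y z i + gam ^+ 2 * dual_norm (Nm i) (Gi - g y i) ^+ 2
    - gam * dotv (Gi - g y i) (y i - z i).
Proof.
move=> Xy Xz gam0 Lgam pu; have [Xu _] := pu.
have h3 := prox_three_point (@cvxXs i) (@grad_om i) (cvxchi (i := i))
  gam0 (Xy i) (Xz i) pu.
have hV := half_sqr_norm_le_bregman (@grad_om i) (@sc_om i) (Xy i) Xu.
have hf := block_descent cvxXs derf (normNm i) (@lipg ^~ i) Xy Xu.
(* The noise is paired with [u - z i], split at [y i]: the part along [u - y i] is bounded by the
   dual norm, while the part along [y i - z i] has mean 0 and is kept. *)
have hd := dotv_le_dual_norm (normNm i) (Gi - g y i) (- (u - y i)).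
rewrite (is_normN (normNm i)) in hd.
move: h3 hV hf hd; rewrite /slope.
set n := Nm i (u - y i); set D := dual_norm _ _.
rewrite !dotvE => h3 hV hf hd.
have n0 : 0 <= n ^+ 2 by exact: sqr_ge0.
have h1 := ler_wpM2l (ltW gam0) hf.
have h2 := ler_wpM2l (ltW gam0) hd.
have h4 : L i * gam * n ^+ 2 <= n ^+ 2 / 2 by nra.
(* AM-GM: [gam D n <= gam^2 D^2 + n^2 / 4] *)
have h5 : 0 <= (gam * D - n / 2) ^+ 2 by exact: sqr_ge0.
nra.
Qed.

Lemma potential_step y z i Gi (gam : R) u :
  in_prod Xs y -> in_prod Xs z -> 0 < gam -> 2 * L i * gam <= 1 ->
  is_prox (Xs i) (om i) (dom i) (chi i) (y i) Gi gam u ->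
  potential gam z (dfwith y i u) <= potential gam z y
    + gam * slope y z i + gam ^+ 2 * dual_norm (Nm i) (Gi - g y i) ^+ 2
    - gam * dotv (Gi - g y i) (y i - z i).
Proof.
move=> Xy Xz gam0 Lgam pu.
have h := bregman_block_step Xy Xz gam0 Lgam pu.
rewrite /potential /phi /V.
rewrite (bigD1 i)//= [\sum_(j < b) chi j (dfwith y i u j)](bigD1 i)//= dfwithin.
under eq_bigr => j ji do rewrite dfwithout 1?eq_sym//.
under [\sum_(j < b | j != i) chi j _]eq_bigr => j ji
  do rewrite dfwithout 1?eq_sym//.
rewrite [in leRHS](bigD1 i)//= [\sum_(j < b) chi j (y j)](bigD1 i)//=.
lra.
Qed.

Lemma sum_slope_le y z : in_prod Xs y -> in_prod Xs z ->
  \sum_(i < b) slope y z i <= - (phi y - phi z) - mu / Q * V y z.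
Proof.
move=> Xy Xz.
have hV : V y z <= Q / 2 * pnorm2 Nm (psub z y).
  rewrite /V /pnorm2 mulr_sumr; apply: ler_sum => i _.
  by rewrite (is_normBC (normNm i) (z i)) bregman_quad.
have hmu : mu / Q * V y z <= mu / 2 * pnorm2 Nm (psub z y).
  have -> : mu / 2 * pnorm2 Nm (psub z y) =
      mu / Q * (Q / 2 * pnorm2 Nm (psub z y)) by field; rewrite gt_eqF.
  by rewrite ler_wpM2l// divr_ge0// ltW.
have := sc_f Xy Xz.
rewrite /slope /phi sumrB big_split /= -/(pdot (g y) (psub z y)).
lra.
Qed.

Lemma integral_dotv_oracle y i (v : 'rV[R]_(nb i)) (C : R) : in_prod Xs y ->
  P.-integrable setT (fun xi => (C + dotv (G y xi i - g y i) v)%:E) /\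
  (\int[P]_xi (C + dotv (G y xi i - g y i) v)%:E = C%:E)%E.
Proof.
move=> Xy.
pose h (j : 'I_(nb i)) xi := ((v ord0 j)%:E * (G y xi i ord0 j)%:E)%E.
pose C' := C - dotv (g y i) v.
have inth j : P.-integrable setT (h j).
  by apply: integrableZl => //; exact: (G_mean j Xy).1.
have intS : P.-integrable setT (fun xi => \sum_(j < nb i) h j xi)%E.
  exact: integrable_sum.
have intC : P.-integrable setT (cst C'%:E).
  exact: finite_measure_integrable_cst.
have E : (fun xi => (C + dotv (G y xi i - g y i) v)%:E) =
    (cst C'%:E \+ (fun xi => \sum_(j < nb i) h j xi))%E.
  apply/funext => xi /=; rewrite dotvDl dotvNl /h.
  under eq_bigr do rewrite -EFinM.
  rewrite sumEFin -EFinD /C'; congr EFin.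
  rewrite addrCA addrC /dotv; congr (_ + _).
  by apply: eq_bigr => j _; rewrite mulrC.
rewrite E; split; first exact: integrableD.
have intCE : (\int[P]_x cst C'%:E x = C'%:E)%E.
  rewrite (eq_integral (cst C'%:E))// integral_cst//.
  by rewrite -[RHS]mule1; congr (_ * _)%E; exact: probability_setT.
rewrite integralD// intCE integral_sum//.
have inthE j : (\int[P]_x h j x = (v ord0 j * g y i ord0 j)%:E)%E.
  by rewrite /h integralZl// ?(G_mean j Xy).2 ?EFinM//; exact: (G_mean j Xy).1.
under eq_bigr do rewrite inthE.
rewrite sumEFin -EFinD; congr EFin.
rewrite /C' -addrA -[RHS]addr0; congr (_ + _); apply/eqP.
rewrite addrC subr_eq0; apply/eqP.
by apply: eq_bigr => j _; rewrite mulrC.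
Qed.

(** [F] is left abstract so that it can be the iterated integral over the remaining draws. Averaging
    divides the summed slopes by [b], which yields both the contraction of [V] and the factor
    [1 - b%:R^-1] on the gap. *)
Lemma expected_potential_step y z (gam C K : R) (F : 'I_b -> Xi -> \bar R) :
  in_prod Xs y -> in_prod Xs z -> 0 < gam -> (forall i, 2 * L i * gam <= 1) ->
  0 < K -> (forall i xi, 0 <= F i xi)%E ->
  (forall i xi, exists2 u,
     is_prox (Xs i) (om i) (dom i) (chi i) (y i) (G y xi i) gam u &
     (F i xi <= (C + K * potential gam z (dfwith y i u))%:E)%E) ->
  ((b%:R^-1)%:E * \sum_(i < b) \int[P]_xi F i xi <=
   (C + K * ((1 - gam * mu / (b%:R * Q)) * V y z
             + gam * (1 - b%:R^-1) * (phi y - phi z)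
             + gam ^+ 2 / b%:R * \sum_(i < b) sigma i ^+ 2))%:E)%E.
Proof.
move=> Xy Xz gam0 Lgam K0 F0 Fu.
have intF i : (\int[P]_xi F i xi <= (C + K * potential gam z y +
    K * gam * slope y z i + (K * gam ^+ 2) * sigma i ^+ 2)%:E)%E.
  (* This vector reproduces the noise term of [potential_step] scaled by [K]; the constant collects
     what does not depend on the sample. *)
  have [inta intA] := @integral_dotv_oracle y i (- (K * gam) *: (y i - z i))
    (C + K * potential gam z y + K * gam * slope y z i) Xy.
  apply: (lower_integral_le_affine _ _ _ inta intA (G_var i Xy)) => //.
  - by rewrite mulr_gt0// exprn_gt0.
  - move=> xi; have [u pu /le_trans] := Fu i xi; apply; rewrite lee_fin.
    have := ler_wpM2l (ltW K0) (potential_step Xy Xz gam0 (Lgam i) pu).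
    by rewrite dotvZr; lra.
  - by move=> xi; exact: sqr_ge0.
have bR : 0 < b%:R :> R by rewrite ltr0n.
have bV0 : (0 <= (b%:R^-1)%:E :> \bar R)%E by rewrite lee_fin invr_ge0 ltW.
apply: le_trans (lee_wpmul2l bV0 (lee_sum _ (fun i _ => intF i))) _.
rewrite sumEFin -EFinM lee_fin !big_split /= !sumr_const card_ord -!mulr_sumr.
have := ler_wpM2l (ltW (mulr_gt0 K0 gam0)) (sum_slope_le Xy Xz).
set SL := \sum_(i < b) slope y z i; set SS := \sum_(i < b) sigma i ^+ 2.
rewrite /potential => slope_le.
rewrite -(ler_pM2l bR) mulrA mulfV ?gt_eqF// mul1r.
rewrite -[C *+ b]mulr_natl -[(K * _) *+ b]mulr_natl.
set v := V y z in slope_le *; set e := phi y - phi z in slope_le *.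
have -> : b%:R * (C + K * ((1 - gam * mu / (b%:R * Q)) * v
      + gam * (1 - b%:R^-1) * e + gam ^+ 2 / b%:R * SS)) =
    b%:R * C + K * (b%:R * v + gam * b%:R * e + gam ^+ 2 * SS)
    + K * gam * (- e - mu / Q * v).
  by field; rewrite !gt_eqF.
lra.
Qed.

(** * The iterates, and telescoping by backward induction *)

Context (x1 : bpoint R nb) (gam theta Gam : nat -> R).
Context (x : nat -> (nat -> 'I_b) -> (nat -> Xi) -> bpoint R nb).
Context (xstar : bpoint R nb) (N : nat).
Hypothesis Xx1 : in_prod Xs x1.
Hypothesis x_init : forall I Z, x 1%N I Z = x1.
Hypothesis x_step : forall (k : nat) I Z, (1 <= k)%N ->
  is_prox (Xs (I k)) (om (I k)) (dom (I k)) (chi (I k))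
    (x k I Z (I k)) (G (x k I Z) (Z k) (I k)) (gam k) (x k.+1 I Z (I k)) /\
  (forall j, j != I k -> x k.+1 I Z j = x k I Z j).
Hypothesis Gam1 : Gam 1%N = 1.
Hypothesis GamS : forall k, (2 <= k)%N ->
  Gam k = Gam k.-1 * (1 - gam k * mu / (b%:R * Q)).
Hypothesis Gam_gt0 : forall k, (1 <= k)%N -> 0 < Gam k.
Hypothesis gam_gt0 : forall k, (1 <= k)%N -> 0 < gam k.
Hypothesis Lgam : forall k i, (1 <= k)%N -> 2 * L i * gam k <= 1.
Hypothesis gam_le : forall k, (1 <= k)%N -> gam k <= b%:R * Q / mu.
Hypothesis thetaS : forall k, (1 <= k)%N ->
  theta k.+1 = b%:R * gam k / Gam k - (b%:R - 1) * gam k.+1 / Gam k.+1.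
Hypothesis Xxstar : in_prod Xs xstar.
Hypothesis xstar_min : forall y, in_prod Xs y -> phi xstar <= phi y.

Lemma iterate_dfwith k I Z : (1 <= k)%N ->
  x k.+1 I Z = dfwith (x k I Z) (I k) (x k.+1 I Z (I k)).
Proof.
move=> k1; apply/functional_extensionality_dep => j.
have [<-|ij] := eqVneq (I k) j; first by rewrite dfwithin.
by rewrite dfwithout// (x_step I Z k1).2// eq_sym.
Qed.

Lemma iterate_in_prod k I Z : (1 <= k)%N -> in_prod Xs (x k I Z).
Proof.
case: k => // k _; elim: k => [|k IH]; first by rewrite x_init.
rewrite iterate_dfwith//; apply: in_prod_dfwith => //.
by have [[]] := x_step I Z (ltn0Sn k).
Qed.

(* Each prox problem has a unique solution, so an iterate is determined by the
   indices and samples drawn before it. *)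
Lemma iterate_adapted k I Z I' Z' : (1 <= k)%N ->
  (forall j, (j < k)%N -> I j = I' j /\ Z j = Z' j) -> x k I Z = x k I' Z'.
Proof.
case: k => // k _; elim: k => [|k IH] II'; first by rewrite !x_init.
have xk : x k.+1 I Z = x k.+1 I' Z'.
  by apply: IH => j jk; apply: II'; exact: ltnW.
rewrite iterate_dfwith// [RHS]iterate_dfwith// -xk.
have [Ik Zk] := II' k.+1 (ltnSn _).
have [p _] := x_step I Z (ltn0Sn k).
have [p' _] := x_step I' Z' (ltn0Sn k).
rewrite -Ik -xk -Zk in p' *.
congr dfwith.
exact: (prox_unique (normNm (I k.+1)) (@cvxXs _) (@grad_om _) (@sc_om _)
  (cvxchi (i := I k.+1)) (gam_gt0 (ltn0Sn k)) (iterate_in_prod I Z (ltn0Sn k) _) p p').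
Qed.

Lemma iterate_upd k j I Z i xi : (1 <= j)%N -> (j <= k)%N ->
  x j (upd I k i) (upd Z k xi) = x j I Z.
Proof.
move=> j1 jk; apply: iterate_adapted => // l lj.
by rewrite /upd ltn_eqF// (leq_trans lj).
Qed.

Lemma Eiter_ge0 m k (h : (nat -> 'I_b) -> (nat -> Xi) -> \bar R) I Z :
  (forall I Z, 0 <= h I Z)%E -> (0 <= Eiter P m k h I Z)%E.
Proof.
move=> h0; elim: m k I Z => [|m IH] k I Z //=.
rewrite mule_ge0 ?lee_fin ?invr_ge0// sume_ge0// => i _.
by apply: integral_ge0 => xi _; exact: IH.
Qed.

Let Delta k I Z := phi (x k I Z) - phi xstar.
Let noise k := \sum_(k <= j < N.+1)
  gam j ^+ 2 / Gam j * \sum_(i < b) sigma i ^+ 2.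
(** Bound, given the draws before [k], on the expected final weighted sum of gaps: the gaps already
    collected, the potential at the current iterate, and the noise still to come. *)
Let value k I Z := \sum_(2 <= j < k.+1) theta j * Delta j I Z
  + b%:R / Gam k * (1 - gam k * mu / (b%:R * Q)) * V (x k I Z) xstar
  + (b%:R - 1) * gam k / Gam k * Delta k I Z + noise k.

Lemma V_ge0 y z : in_prod Xs y -> in_prod Xs z -> 0 <= V y z.
Proof.
move=> Xy Xz; apply: sumr_ge0 => i _.
apply: le_trans (half_sqr_norm_le_bregman (@grad_om i) (@sc_om i) (Xy i) (Xz i)).
by rewrite divr_ge0// sqr_ge0.
Qed.

Lemma Delta_ge0 k I Z : (1 <= k)%N -> 0 <= Delta k I Z.
Proof. by move=> k1; rewrite subr_ge0 xstar_min//; exact: iterate_in_prod. Qed.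

(** The recursion for [Gam] absorbs the contraction factor of [V], and [theta k.+1] complements the
    remaining gap coefficient to [b%:R * gam k / Gam k]; together they form one multiple of
    [potential]. *)
Lemma value_step k I Z : (1 <= k)%N ->
  value k.+1 I Z = \sum_(2 <= j < k.+1) theta j * Delta j I Z + noise k.+1
    + b%:R / Gam k * potential (gam k) xstar (x k.+1 I Z).
Proof.
move=> k1; rewrite /value big_nat_recr//= thetaS// /potential -/(Delta _ _ _).
have Gk := Gam_gt0 k1; have Gk1 := Gam_gt0 (ltn0Sn k).
have bR : b%:R != 0 :> R by rewrite pnatr_eq0 -lt0n.
move: Gk1; rewrite (GamS (k := k.+1))//= pmulr_rgt0// => rk.
set r := 1 - _ in rk *.
field; rewrite !gt_eqF//.
Qed.

Lemma Eiter_le_value (S : R) (H : (nat -> 'I_b) -> (nat -> Xi) -> \bar R) m k I Z :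
  (1 <= k)%N -> (k + m = N.+1)%N -> 0 < S -> (forall I Z, 0 <= H I Z)%E ->
  (forall I Z, H I Z <= (S * \sum_(2 <= j < N.+2) theta j * Delta j I Z)%:E)%E ->
  (Eiter P m k H I Z <= (S * value k I Z)%:E)%E.
Proof.
move=> + + S0 H0 HS; elim: m k I Z => [|m IH] k I Z k1.
  (* With no draw left, [value] exceeds the weighted sum by multiples of [V] and of the last gap.
     The upper bound on [gam] makes the coefficient of [V] nonnegative. *)
  rewrite addn0 => kN; apply: le_trans (HS I Z) _; rewrite lee_fin ler_pM2l//.
  rewrite /value {1 2}kN /noise kN [X in _ + X]big_geq// addr0 -addrA lerDl.
  have Gk := Gam_gt0 (ltn0Sn N); have gk := gam_gt0 (ltn0Sn N).
  have A0 : 0 <= b%:R / Gam N.+1 * (1 - gam N.+1 * mu / (b%:R * Q)).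
    rewrite mulr_ge0 ?divr_ge0 ?ler0n ?(ltW Gk)// subr_ge0.
    have bQ : 0 < b%:R * Q by rewrite mulr_gt0// ltr0n.
    by rewrite ler_pdivrMr// mul1r -ler_pdivlMr// gam_le.
  have B0 : 0 <= (b%:R - 1) * gam N.+1 / Gam N.+1.
    by rewrite divr_ge0 ?(ltW Gk)// mulr_ge0 ?(ltW gk)// subr_ge0 ler1n.
  have X0 : in_prod Xs (x N.+1 I Z) by exact: iterate_in_prod.
  by rewrite addr_ge0// mulr_ge0// ?V_ge0// Delta_ge0.
move=> kmN.
have km : (k.+1 + m = N.+1)%N by rewrite -kmN addnS.
have Gk := Gam_gt0 k1.
have bR : 0 < b%:R :> R by rewrite ltr0n.
(* The part of [value k.+1] that is unaffected by draw [k]. *)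
pose C := S * (\sum_(2 <= j < k.+1) theta j * Delta j I Z + noise k.+1).
have K0 : 0 < S * (b%:R / Gam k) by rewrite mulr_gt0// divr_gt0.
have F0 i xi : (0 <= Eiter P m k.+1 H (upd I k i) (upd Z k xi))%E.
  exact: Eiter_ge0.
apply: le_trans (expected_potential_step (C := C) (iterate_in_prod I Z k1)
  Xxstar (gam_gt0 k1) (fun i => Lgam i k1) K0 F0 _) _.
  move=> i xi; have [p _] := x_step (upd I k i) (upd Z k xi) k1.
  have ukE : upd I k i k = i by rewrite /upd eqxx.
  have uZE : upd Z k xi k = xi by rewrite /upd eqxx.
  have xd := @iterate_dfwith k (upd I k i) (upd Z k xi) k1.
  rewrite ukE uZE iterate_upd// in p xd.
  exists (x k.+1 (upd I k i) (upd Z k xi) i); first by [].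
  apply: le_trans (IH _ _ _ (ltn0Sn k) km) _.
  rewrite lee_fin value_step// -xd /C.
  rewrite (eq_big_nat _ _ (F2 := fun j => theta j * Delta j I Z)); last first.
    by move=> j /andP[j2 jk]; rewrite /Delta iterate_upd// ltnW.
  by rewrite [leLHS]mulrDr [S * (_ / _ * _)]mulrA.
rewrite lee_fin /value /C [noise k](_ : _ = gam k ^+ 2 / Gam k *
  (\sum_(i < b) sigma i ^+ 2) + noise k.+1); last first.
  by rewrite /noise big_ltn// -kmN -addSnnS leq_addr.
rewrite -/(Delta k I Z) le_eqVlt; apply/orP; left; apply/eqP.
field; rewrite !gt_eqF//.
Qed.

(** * The averaged output *)

Hypothesis cvxf : forall y z (t : R), in_prod Xs y -> in_prod Xs z ->
  0 <= t <= 1 ->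
  f (padd (pscale t y) (pscale (1 - t) z)) <= t * f y + (1 - t) * f z.
Hypothesis theta_ge0 : forall k, (1 <= k)%N -> 0 <= theta k.
Let Stheta := \sum_(2 <= k < N.+2) theta k.
Hypothesis Stheta_gt0 : 0 < Stheta.
Let xbar I Z : bpoint R nb :=
  fun i => Stheta^-1 *: \sum_(2 <= k < N.+2) theta k *: x k I Z i.

Lemma in_prod_convex y z (t : R) : in_prod Xs y -> in_prod Xs z ->
  0 <= t <= 1 -> in_prod Xs (padd (pscale t y) (pscale (1 - t) z)).
Proof. by move=> Xy Xz t01 i; exact: cvxXs. Qed.

Lemma phi_convex y z (t : R) : in_prod Xs y -> in_prod Xs z -> 0 <= t <= 1 ->
  phi (padd (pscale t y) (pscale (1 - t) z)) <= t * phi y + (1 - t) * phi z.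
Proof.
move=> Xy Xz t01; rewrite /phi !mulrDr addrACA lerD ?cvxf//.
by rewrite !mulr_sumr -big_split ler_sum// => i _; exact: cvxchi.
Qed.

(** The upper bound is Jensen's inequality for [phi]. The lower bound, from optimality of [xstar],
    supplies the nonnegativity on which the lower integrals rely. *)
Lemma average_gap I Z :
  0 <= phi (xbar I Z) - phi xstar <=
  Stheta^-1 * \sum_(2 <= j < N.+2) theta j * Delta j I Z.
Proof.
have s1 j : j \in index_iota 2 N.+2 -> (1 <= j)%N.
  by rewrite mem_index_iota => /andP[/ltnW].
have [|||Xbar phibar] := jensen_bpoint in_prod_convex phi_convex
  (s := index_iota 2 N.+2) (w := theta) (p := fun k => x k I Z).
- by move=> j /s1; exact: theta_ge0.
- by move=> j /s1; exact: iterate_in_prod.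
- exact: Stheta_gt0.
rewrite subr_ge0 xstar_min//= mulrC ler_pdivlMr// mulrC mulrBr.
under eq_bigr do rewrite mulrBr.
by rewrite sumrB -mulr_suml lerB.
Qed.

Lemma sbmd_expected_gap I Z :
  (Eiter P N 1 (fun I Z => (phi (xbar I Z) - phi xstar)%:E) I Z <=
   (Stheta^-1 *
     ((b%:R - mu * gam 1%N / Q) * V x1 xstar
      + (b%:R - 1) * gam 1%N * (phi x1 - phi xstar)
      + \sum_(1 <= k < N.+1) gam k ^+ 2 / Gam k * \sum_(i < b) sigma i ^+ 2))%:E)%E.
Proof.
have gap := average_gap.
apply: le_trans (@Eiter_le_value Stheta^-1 _ N 1 I Z isT (add1n N) _ _ _) _.
- by rewrite invr_gt0.
- by move=> I' Z'; rewrite lee_fin; case/andP: (gap I' Z').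
- by move=> I' Z'; rewrite lee_fin; case/andP: (gap I' Z').
(* Before any draw the collected sum is empty and the iterate is [x1], so [value 1] is
   deterministic. *)
rewrite lee_fin /value /Delta x_init Gam1 big_geq// add0r !divr1.
have -> : b%:R * (1 - gam 1%N * mu / (b%:R * Q)) = b%:R - mu * gam 1%N / Q.
  by field; rewrite !gt_eqF// ltr0n.
exact: lexx.
Qed.

End stochastic_block_mirror_descent.

Unset Implicit Arguments.

Theorem theorem3p3
  (R : realType) (b : nat) (nb : 'I_b -> nat)
  (* sets X_i and norms *)
  (Xs : forall i : 'I_b, set 'rV[R]_(nb i))
  (Nm : forall i : 'I_b, 'rV[R]_(nb i) -> R)
  (* objective *)
  (f : bpoint R nb -> R) (g : bpoint R nb -> bpoint R nb)
  (chi : forall i : 'I_b, 'rV[R]_(nb i) -> R)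
  (L : 'I_b -> R) (Lbar : R)
  (* stochastic oracle *)
  (d : measure_display) (Xi : measurableType d) (P : probability Xi R)
  (G : bpoint R nb -> Xi -> bpoint R nb) (sigma : 'I_b -> R)
  (* prox setup *)
  (om : forall i : 'I_b, 'rV[R]_(nb i) -> R)
  (dom : forall i : 'I_b, 'rV[R]_(nb i) -> 'rV[R]_(nb i))
  (mu Q : R)
  (* method parameters and iterates *)
  (x1 : bpoint R nb) (gam theta Gam : nat -> R)
  (x : nat -> (nat -> 'I_b) -> (nat -> Xi) -> bpoint R nb)
  (xstar : bpoint R nb) (N : nat) :
  (0 < b)%N ->
  (* block structure *)
  (forall i, Xs i !=set0) ->
  (forall i, closed (Xs i)) ->
  (forall i, cvx_subset (Xs i)) ->
  (forall i, is_norm (Nm i)) ->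
  (* f convex, differentiable with gradient g *)
  (forall y z (t : R), in_prod Xs y -> in_prod Xs z -> 0 <= t <= 1 ->
     f (padd (pscale t y) (pscale (1 - t) z)) <= t * f y + (1 - t) * f z) ->
  (forall y v : bpoint R nb,
     is_derive (0 : R) 1 (fun t : R => f (padd y (pscale t v))) (pdot (g y) v)) ->
  (* block Lipschitz gradient *)
  (forall (y : bpoint R nb) (i : 'I_b) (rho : 'rV[R]_(nb i)),
     in_prod Xs y -> in_prod Xs (dfwith y i (y i + rho)) ->
     dual_norm (Nm i) (g (dfwith y i (y i + rho)) i - g y i) <= L i * Nm i rho) ->
  (* chi_i closed convex *)
  (forall i, cvx_function (chi i)) ->
  (* oracle: unbiased with block variances sigma_i^2 *)
  (forall (y : bpoint R nb) (i : 'I_b) (j : 'I_(nb i)), in_prod Xs y ->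
     P.-integrable setT (fun xi => (G y xi i ord0 j)%:E) /\
     (\int[P]_xi (G y xi i ord0 j)%:E = (g y i ord0 j)%:E)%E) ->
  (forall (y : bpoint R nb) (i : 'I_b), in_prod Xs y ->
     (\int[P]_xi ((dual_norm (Nm i) (G y xi i - g y i)) ^+ 2)%:E
        <= (sigma i ^+ 2)%:E)%E) ->
  (* distance generating functions *)
  (forall i, {within Xs i, continuous (om i)}) ->
  (forall i, {within Xs i, continuous (dom i)}) ->
  (forall i, grad_on (Xs i) (om i) (dom i)) ->
  (forall i, one_strongly_convex_on (Xs i) (Nm i) (om i)) ->
  (* the method: x_1 given, i_k uniform (p_i = 1/b), prox update of block i_k *)
  in_prod Xs x1 ->
  (forall I Z, x 1%N I Z = x1) ->
  (forall (k : nat) I Z, (1 <= k)%N ->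
     is_prox (Xs (I k)) (om (I k)) (dom (I k)) (chi (I k))
       (x k I Z (I k)) (G (x k I Z) (Z k) (I k)) (gam k) (x k.+1 I Z (I k)) /\
     (forall j, j != I k -> x k.+1 I Z j = x k I Z j)) ->
  (* strong convexity of f *)
  0 < mu ->
  (forall y z, in_prod Xs y -> in_prod Xs z ->
     f z >= f y + pdot (g y) (psub z y) + mu / 2 * pnorm2 Nm (psub z y)) ->
  (* quadratic growth of the Bregman distances *)
  0 < Q ->
  (forall i z y, Xs i z -> Xs i y ->
     bregman (om i) (dom i) z y <= Q / 2 * Nm i (z - y) ^+ 2) ->
  (* step sizes and weights *)
  (forall i, L i <= Lbar) -> (exists i, L i = Lbar) ->
  Gam 1%N = 1 ->
  (forall k, (2 <= k)%N -> Gam k = Gam k.-1 * (1 - gam k * mu / (b%:R * Q))) ->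
  (forall k, (1 <= k)%N -> 0 < Gam k) ->
  (forall k, (1 <= k)%N ->
     [/\ 0 < gam k, 2 * Lbar * gam k <= 1 & gam k <= b%:R * Q / mu]) ->
  theta 1%N = 0 ->
  (forall k, (1 <= k)%N ->
     theta k.+1 = b%:R * gam k / Gam k - (b%:R - 1) * gam k.+1 / Gam k.+1) ->
  (forall k, (1 <= k)%N -> 0 <= theta k) ->
  (* x* is the optimal solution of min_{x in X} phi(x) *)
  let phi := fun y : bpoint R nb => f y + \sum_(i < b) chi i (y i) in
  in_prod Xs xstar ->
  (forall y, in_prod Xs y -> phi xstar <= phi y) ->
  (2 <= N)%N ->
  let Stheta := \sum_(2 <= k < N.+2) theta k in
  0 < Stheta ->
  let xbar := fun I Z => (fun i => Stheta^-1 *: \sum_(2 <= k < N.+2) theta k *: x k I Z i)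
    : bpoint R nb in
  forall (I0 : nat -> 'I_b) (Z0 : nat -> Xi),
  (Eiter P N 1 (fun I Z => (phi (xbar I Z) - phi xstar)%:E) I0 Z0
   <= (Stheta^-1 *
        ((b%:R - mu * gam 1%N / Q) *
           \sum_(i < b) bregman (om i) (dom i) (x1 i) (xstar i)
         + (b%:R - 1) * gam 1%N * (phi x1 - phi xstar)
         + \sum_(1 <= k < N.+1) gam k ^+ 2 / Gam k * \sum_(i < b) sigma i ^+ 2))%:E)%E.
Proof.
move=> b0 _ _ cvxXs normNm cvxf derf lipg cvxchi G_mean G_var _ _ grad_om sc_om
  Xx1 x_init x_step mu0 sc_f Q0 bregman_quad L_le _ Gam1 GamS Gam0 gamP _
  thetaS theta0 phi Xxstar xstar_min _ Stheta Stheta0 xbar I0 Z0.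
have gam0 k : (1 <= k)%N -> 0 < gam k by case/gamP.
have gam_le k : (1 <= k)%N -> gam k <= b%:R * Q / mu by case/gamP.
have Lgam k i : (1 <= k)%N -> 2 * L i * gam k <= 1.
  move=> k1; have [gk Lk _] := gamP k k1.
  by apply: le_trans Lk; rewrite ler_pM2r// ler_pM2l.
exact: (sbmd_expected_gap b0 cvxXs normNm derf lipg cvxchi G_mean G_var grad_om
  sc_om mu0 sc_f Q0 bregman_quad Xx1 x_init x_step Gam1 GamS Gam0 gam0 Lgam
  gam_le thetaS Xxstar xstar_min cvxf theta0 Stheta0).
Qed.
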